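(* (Exception Masking Principle) In Resilient TX10, let $p\notin\mathrm{dom}(g)$ and let $\langle s,g\rangle\xrightarrow{\lambda}_p k$ be a transition. If $\lambda=v\otimes$, then $v=\mathsf{DP}$.
   Context: **Syntax.** $\mathsf{Pl}=\{0,\dots,n-1\}$ is a finite set of places (ranged over by $p,q$). $\mathsf{ObjId}$ is an infinite set of object ids with a fixed bijection with $\mathbb N$ (the enumeration order); $\mathsf p:\mathsf{ObjId}\to\mathsf{Pl}$ gives the home place; $\mathsf{ObjId}_q=\{o:\mathsf p(o)=q\}$; global references are $\mathsf{grObjId}=\{o\$p : o\in\mathsf{ObjId}_p\}$. Values $v$: object ids $o$, global references $o\$p$, exception constants $\mathsf E,\mathsf{BF},\mathsf{BG},\mathsf{DP}$ ($\mathsf{DP}$ is the dead place exception). Expressions: $e::= v\mid x\mid e.f\mid\{f_1{:}e_1,\dots,f_n{:}e_n\}\mid \mathtt{globalref}\ e\mid\mathtt{valof}\ e$. Statements: $s,t::=\mathtt{skip}\mid\mathtt{throw}\ v$ ($v$ an exception constant) $\mid \mathtt{val}\ x=e\ s\mid e.f=e'\mid\{s\ t\}\mid\mathtt{at}(p)(\mathtt{val}\ x=e)\,s\mid\mathtt{async}\ s\mid\mathtt{finish}\ s\mid\mathtt{try}\ s\ \mathtt{catch}\ t$, plus the dynamic (runtime only) statements $\overline{\mathtt{at}}(p)\,s\mid\overline{\mathtt{async}}\,s\mid\mathtt{finish}_\mu\,s$ with $\mu$ a finite set of exception values; $\mathtt{finish}\ s$ abbreviates $\mathtt{finish}_\emptyset\,s$.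 In $\mathtt{val}\ x=e\ s$ and $\mathtt{at}(p)(\mathtt{val}\ x=e)s$ the only free variable of $s$ is $x$. **Heaps.** A local heap $h$ is a finite partial map from object ids to objects, an object being a finite partial map from field names to values. A global heap $g$ is a partial map from $\mathsf{Pl}$ to local heaps; $\mathrm{dom}(g)$ is the set of non-failed places. $f[a\mapsto b]$ denotes map update. **Predicates.** $\mathsf{isAsync}(\overline{\mathtt{async}}\,s)$; $\mathsf{isAsync}(s)$ implies $\mathsf{isAsync}(\overline{\mathtt{at}}(p)s)$ and $\mathsf{isAsync}(\mathtt{try}\,s\,\mathtt{catch}\,t)$; $\mathsf{isAsync}(s)$ and $\mathsf{isAsync}(t)$ imply $\mathsf{isAsync}(\{s\ t\})$. $\mathsf{isSync}$ holds of $\mathtt{skip}$, $\mathtt{val}\ x=e\ s$, $e.f=e'$, $\mathtt{at}(p)(\mathtt{val}\ x=e)s$, $\mathtt{async}\ s$, $\mathtt{finish}_\mu\,s$, $\mathtt{throw}\ v$; and $\mathsf{isSync}(s)$ implies $\mathsf{isSync}$ of $\{s\ t\}$, $\{t\ s\}$, $\overline{\mathtt{at}}(p)s$, $\mathtt{try}\,s\,\mathtt{catch}\,t$. **Transitions.** Configurations $k$ are $\langle s,g\rangle$ or $g$ (terminated). Labels $\lambda$: $\epsilon$ (normal), $v\otimes$ (synchronous exception), $v\times$ (asynchronous exception). $\to_p$ means $\xrightarrow{\epsilon}_p$. In rules, ''$A\mid B$'' in premise and conclusion denotes two rules, matching first with first and second with second. *Expressions* (at place $p$, local heap $h$): $\langle\{f_1{:}v_1,\dots,f_n{:}v_n\},h\rangle\to_p\langle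 o,h[o\mapsto\{f_i\mapsto v_i\}]\rangle$ with $o\in\mathsf{ObjId}_p\setminus\mathrm{dom}(h)$; $\langle o.f,h\rangle\to_p\langle v,h\rangle$ if $h(o)(f)=v$; $\langle o.f,h\rangle\xrightarrow{\mathsf{BF}\otimes}_p h$ if $f\notin\mathrm{dom}(h(o))$; $\langle\mathtt{globalref}\ o,h\rangle\to_p\langle o\$p,h\rangle$; $\langle\mathtt{valof}\ o\$p,h\rangle\to_p\langle o,h\rangle$; $\langle\mathtt{valof}\ v,h\rangle\xrightarrow{\mathsf{BG}\otimes}_p h$ if $v$ is not of the form $o\$p$; and if $\langle e,h\rangle\xrightarrow{\lambda}_p\langle e',h'\rangle\mid h$ then the same label is taken in the contexts $[\,].f$, $\mathtt{globalref}\,[\,]$, $\mathtt{valof}\,[\,]$, $\{f_1{:}v_1,\dots,f_i{:}v_i,f_{i+1}{:}[\,],\dots\}$ (leading to $h$ in the exceptional case). *Basic statements* (all require $p\in\mathrm{dom}(g)$): $\langle\mathtt{skip},g\rangle\to_p g$; $\langle\mathtt{throw}\ v,g\rangle\xrightarrow{v\otimes}_p g$; if $\langle s[v/x],g\rangle\xrightarrow{\lambda}_p\langle s',g'\rangle\mid g'$ then $\langle\mathtt{val}\ x=v\ s,g\rangle\xrightarrow{\lambda}_p\langle s',g'\rangle\mid g'$; $\langle o.f=v,g\rangle\to_p g[p\mapsto g(p)[o\mapsto g(p)(o)[f\mapsto v]]]$ if $f\in\mathrm{dom}(g(p)(o))$; $\langle o.f=v,g\rangle\xrightarrow{\mathsf{BF}\otimes}_p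 g$ if $f\notin\mathrm{dom}(g(p)(o))$; (Ctx) if $\langle e,g(p)\rangle\xrightarrow{\lambda}_p\langle e',h'\rangle\mid h'$ and $g'=g[p\mapsto h']$ then $\mathtt{val}\ x=e\ s$, $e.f=e_1$, $o.f=e$, $\mathtt{at}(q)(\mathtt{val}\ x=e)s$ in heap $g$ make a $\lambda$-step at $p$ to the same statement with $e'$ for $e$ in heap $g'$, resp. to $g'$. *Copy.* For $o\in\mathsf{ObjId}$ and $q\in\mathrm{dom}(g)$, $\mathsf{copy}(o,q,g)=(o',g[q\mapsto h'])$ where $h'$ extends $h=g(q)$ by a fresh isomorphic copy, rooted at $o'$, of the object graph reachable from $o$ in $g(\mathsf p(o))$; the new ids are the next unused elements of $\mathsf{ObjId}_q$ and global references are preserved unchanged. For other values $\mathsf{copy}(v,q,g)=(v,g)$. *Remaining Resilient TX10 rules:* (Place Failure) for $p\in\mathrm{dom}(g)$, $p\neq0$: $\langle s,g\rangle\to_p\langle s,g\setminus\{(p,g(p))\}\rangle$. (Local Failure) if $p\notin\mathrm{dom}(g)$, each of $\mathtt{skip}$, $\mathtt{throw}\ v$, $\mathtt{val}\ x=e\ s$, $e_1.f=e_2$ in heap $g$ makes a step $\xrightarrow{\mathsf{DP}\otimes}_p g$. (Spawn) $\langle\mathtt{async}\ s,g\rangle\to_p\langle\overline{\mathtt{async}}\,s,g\rangle$ if $p\in\mathrm{dom}(g)$; $\langle\mathtt{async}\ s,g\rangle\xrightarrow{\mathsf{DP}\otimes}_p g$ if $p\notin\mathrm{dom}(g)$. (Async)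 if $\langle s,g\rangle\xrightarrow{\lambda}_p\langle s',g'\rangle\mid g'$ then $\langle\overline{\mathtt{async}}\,s,g\rangle\xrightarrow{\lambda'}_p\langle\overline{\mathtt{async}}\,s',g'\rangle\mid g'$, with $\lambda'=\epsilon$ if $\lambda=\epsilon$ and $\lambda'=v\times$ if $\lambda\in\{v\times,v\otimes\}$. (Finish) if $\langle s,g\rangle\xrightarrow{\lambda}_p\langle s',g'\rangle$ then $\langle\mathtt{finish}_\mu s,g\rangle\to_p\langle\mathtt{finish}_{\mu\cup\lambda}s',g'\rangle$, where $\mu\cup\epsilon=\mu$ and $\mu\cup v\times=\mu\cup v\otimes=\mu\cup\{v\}$. (End of Finish) if $\langle s,g\rangle\xrightarrow{\lambda}_p g'$ then $\langle\mathtt{finish}_\mu s,g\rangle\xrightarrow{\lambda'}_p g'$ with $\lambda'=\epsilon$ if $\mu\cup\lambda=\emptyset$; otherwise $\lambda'=\mathsf E\otimes$ if $p\in\mathrm{dom}(g)$ and $\lambda'=\mathsf{DP}\otimes$ if $p\notin\mathrm{dom}(g)$. (Seq) if $\langle s,g\rangle\xrightarrow{\lambda}_p\langle s',g'\rangle$: $\langle\{s\ t\},g\rangle\xrightarrow{\lambda}_p\langle\{s'\ t\},g'\rangle$ if $\lambda\in\{\epsilon,v\times\}$, and $\langle\{s\ t\},g\rangle\xrightarrow{\lambda}_p\langle s',g'\rangle$ if $\lambda=v\otimes$. (Par) if $\mathsf{isAsync}(t)$ and $\langle s,g\rangle\xrightarrow{\lambda}_p\langle s',g'\rangle\mid g'$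 then $\langle\{t\ s\},g\rangle\xrightarrow{\lambda}_p\langle\{t\ s'\},g'\rangle\mid\langle t,g'\rangle$. (Seq Term) if $p\in\mathrm{dom}(g)$ and $\langle s,g\rangle\xrightarrow{\lambda}_p g'$: $\langle\{s\ t\},g\rangle\xrightarrow{\lambda}_p\langle t,g'\rangle$ if $\lambda\in\{\epsilon,v\times\}$, and $\langle\{s\ t\},g\rangle\xrightarrow{\lambda}_p g'$ if $\lambda=v\otimes$. (Seq Failed Term) if $p\notin\mathrm{dom}(g)$ and $\langle s,g\rangle\xrightarrow{\lambda}_p g'$: $\langle\{s\ t\},g\rangle\xrightarrow{\mathsf{DP}\otimes}_p g'$ if $\mathsf{isSync}(s)$, and $\langle\{s\ t\},g\rangle\xrightarrow{\mathsf{DP}\times}_p\langle t,g'\rangle$ if $\mathsf{isAsync}(s)$. (Place Shift) if $p,q\in\mathrm{dom}(g)$ and $(v',g')=\mathsf{copy}(v,q,g)$, $\langle\mathtt{at}(q)(\mathtt{val}\ x=v)s,g\rangle\to_p\langle\overline{\mathtt{at}}(q)\{s[v'/x]\ \mathtt{skip}\},g'\rangle$; if $q\notin\mathrm{dom}(g)$ or $p\notin\mathrm{dom}(g)$, $\langle\mathtt{at}(q)(\mathtt{val}\ x=e)s,g\rangle\xrightarrow{\mathsf{DP}\otimes}_p g$. (At) if $\langle s,g\rangle\xrightarrow{\lambda}_q\langle s',g'\rangle\mid g'$ then $\langle\overline{\mathtt{at}}(q)s,g\rangle\xrightarrow{\lambda'}_p\langle\overline{\mathtt{at}}(q)s',g'\rangle\mid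 g'$, where $\lambda'=\mathsf{DP}\otimes$ if $\lambda=v\otimes$ and $p\notin\mathrm{dom}(g)$, and $\lambda'=\lambda$ otherwise. (Try) if $\langle s,g\rangle\xrightarrow{\lambda}_p\langle s',g'\rangle\mid g'$: if $\lambda\in\{\epsilon,v\times\}$, $\langle\mathtt{try}\,s\,\mathtt{catch}\,t,g\rangle\xrightarrow{\lambda}_p\langle\mathtt{try}\,s'\,\mathtt{catch}\,t,g'\rangle\mid g'$; if $p\in\mathrm{dom}(g)$, $\lambda=v\otimes$, $\langle\mathtt{try}\,s\,\mathtt{catch}\,t,g\rangle\to_p\langle\{s'\ t\},g'\rangle\mid\langle t,g'\rangle$; if $p\notin\mathrm{dom}(g)$, $\lambda=\mathsf{DP}\otimes$, $\langle\mathtt{try}\,s\,\mathtt{catch}\,t,g\rangle\xrightarrow{\lambda}_p\langle s',g'\rangle\mid g'$. *)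

(* Defs.v *)
From HB Require Import structures.
From mathcomp Require Import all_boot.
From mathcomp Require Import finmap.

Set Implicit Arguments.
Unset Strict Implicit.
Unset Printing Implicit Defensive.

Local Open Scope fset_scope.
Local Open Scope fmap_scope.

(* The sets the calculus is parameterised by. [oid_enum] is the fixed
   bijection of object ids with the naturals. *)
Record tx10 := TX10 {
  nplaces : nat;
  oid : choiceType;
  oid_enum : oid -> nat;
  oid_enum_bij : bijective oid_enum;
  home : oid -> 'I_nplaces;
  field : choiceType;
  var : eqType
}.

Inductive exn := excE | excBF | excBG | excDP.

Definition exn_code (v : exn) : bool * bool :=
  match v with
  | excE => (false, false) | excBF => (false, true)
  | excBG => (true, false) | excDP => (true, true)
  end.
Definition exn_decode (b : bool * bool) : exn :=
  match b with
  | (false, false) => excE | (false, true) => excBF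
  | (true, false) => excBG | (true, true) => excDP
  end.
Lemma exn_codeK : cancel exn_code exn_decode.
Proof. by case. Qed.
HB.instance Definition _ := Finite.copy exn (can_type exn_codeK).

(* [Sync v] is the label of a synchronous exception (v with a circled cross),
   [Async v] that of an asynchronous one (v with a plain cross). *)
Inductive label := Eps | Sync of exn | Async of exn.

Definition is_sync_label (lam : label) : bool :=
  if lam is Sync _ then true else false.

Definition add_label (mu : {set exn}) (lam : label) : {set exn} :=
  match lam with Eps => mu | Sync v | Async v => (v |: mu)%SET end.

Section Calculus.

Variable P : tx10.

Definition place := 'I_(nplaces P).

(* Global references: the element (o, p) is o$p. *)
Definition grobjid := {x : oid P * place | home x.1 == x.2}.

Inductive val :=
| VOid of oid P
| VGref of grobjid
| VExn of exn.

Inductive expr :=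
| EVal of val
| EVar of var P
| ESel of expr & field P
| ERec of seq (field P * expr)
| EGref of expr
| EValof of expr.

Inductive stmt :=
| SSkip
| SThrow of exn
| SVal of var P & expr & stmt                 (* val x = e s *)
| SAssign of expr & field P & expr            (* e.f = e' *)
| SSeq of stmt & stmt
| SAt of place & var P & expr & stmt          (* at(p)(val x = e) s *)
| SAsync of stmt
| SFinish of {set exn} & stmt                 (* finish_mu s *)
| STry of stmt & stmt
| SBarAt of place & stmt                      (* dynamic at *)
| SBarAsync of stmt.                          (* dynamic async *)

Fixpoint free_expr (y : var P) (e : expr) : bool :=
  match e with
  | EVal _ => false
  | EVar x => x == y
  | ESel e f => free_expr y e
  | ERec fes => has (fun fe => free_expr y fe.2) fes
  | EGref e | EValof e => free_expr y e
  end.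

Fixpoint free_stmt (y : var P) (s : stmt) : bool :=
  match s with
  | SSkip | SThrow _ => false
  | SVal x e s | SAt _ x e s => free_expr y e || (x != y) && free_stmt y s
  | SAssign e _ e' => free_expr y e || free_expr y e'
  | SSeq s t | STry s t => free_stmt y s || free_stmt y t
  | SAsync s | SFinish _ s | SBarAt _ s | SBarAsync s => free_stmt y s
  end.

Fixpoint wf_stmt (s : stmt) : Prop :=
  match s with
  | SSkip | SThrow _ | SAssign _ _ _ => True
  | SVal x _ s | SAt _ x _ s =>
      (forall y, free_stmt y s -> y = x) /\ wf_stmt s
  | SSeq s t | STry s t => wf_stmt s /\ wf_stmt t
  | SAsync s | SFinish _ s | SBarAt _ s | SBarAsync s => wf_stmt s
  end.

Fixpoint subst_expr (v : val) (y : var P) (e : expr) : expr :=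
  match e with
  | EVal _ => e
  | EVar x => if x == y then EVal v else e
  | ESel e f => ESel (subst_expr v y e) f
  | ERec fes => ERec [seq (fe.1, subst_expr v y fe.2) | fe <- fes]
  | EGref e => EGref (subst_expr v y e)
  | EValof e => EValof (subst_expr v y e)
  end.

Fixpoint subst_stmt (v : val) (y : var P) (s : stmt) : stmt :=
  match s with
  | SSkip | SThrow _ => s
  | SVal x e s =>
      SVal x (subst_expr v y e) (if x == y then s else subst_stmt v y s)
  | SAssign e f e' => SAssign (subst_expr v y e) f (subst_expr v y e')
  | SSeq s t => SSeq (subst_stmt v y s) (subst_stmt v y t)
  | SAt q x e s =>
      SAt q x (subst_expr v y e) (if x == y then s else subst_stmt v y s)
  | SAsync s => SAsync (subst_stmt v y s)
  | SFinish mu s => SFinish mu (subst_stmt v y s)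
  | STry s t => STry (subst_stmt v y s) (subst_stmt v y t)
  | SBarAt q s => SBarAt q (subst_stmt v y s)
  | SBarAsync s => SBarAsync (subst_stmt v y s)
  end.

Definition obj := {fmap field P -> val}.
Definition lheap := {fmap oid P -> obj}.
Definition gheap := {fmap place -> lheap}.

(* The object {f_1 |-> v_1, ...}; field names are meant to be distinct, and
   otherwise the leftmost binding wins. *)
Definition mk_obj (fvs : seq (field P * val)) : obj :=
  foldr (fun fv (r : obj) => r.[fv.1 <- fv.2]) [fmap] fvs.

Inductive is_async : stmt -> Prop :=
| isAsync_bar s : is_async (SBarAsync s)
| isAsync_at q s : is_async s -> is_async (SBarAt q s)
| isAsync_try s t : is_async s -> is_async (STry s t)
| isAsync_seq s t : is_async s -> is_async t -> is_async (SSeq s t).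

Inductive is_sync : stmt -> Prop :=
| isSync_skip : is_sync SSkip
| isSync_val x e s : is_sync (SVal x e s)
| isSync_assign e f e' : is_sync (SAssign e f e')
| isSync_at q x e s : is_sync (SAt q x e s)
| isSync_async s : is_sync (SAsync s)
| isSync_finish mu s : is_sync (SFinish mu s)
| isSync_throw v : is_sync (SThrow v)
| isSync_seql s t : is_sync s -> is_sync (SSeq s t)
| isSync_seqr s t : is_sync s -> is_sync (SSeq t s)
| isSync_barat q s : is_sync s -> is_sync (SBarAt q s)
| isSync_try s t : is_sync s -> is_sync (STry s t).

(* Object graphs and copy *)

Inductive reach (h : lheap) (o : oid P) : oid P -> Prop :=
| reach_root : reach h o o
| reach_field x (r : obj) f y :
    reach h o x -> h.[? x] = Some r -> r.[? f] = Some (VOid y) -> reach h o y.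

Definition rename_val (phi : oid P -> oid P) (v : val) : val :=
  if v is VOid o then VOid (phi o) else v.

Definition rename_obj (phi : oid P -> oid P) (r : obj) : obj :=
  [fmap f : domf r => rename_val phi (r f)].

(* [phi] sends the i-th id reachable from [o] in [h0], in enumeration order,
   to the i-th id of [ObjId_q] that is unused in [h]. *)
Definition next_unused_renaming (h0 : lheap) (o : oid P) (q : place)
    (h : lheap) (phi : oid P -> oid P) : Prop :=
  [/\ forall x, reach h0 o x -> home (phi x) = q /\ phi x \notin domf h,
      forall x y, reach h0 o x -> reach h0 o y ->
        oid_enum x < oid_enum y -> oid_enum (phi x) < oid_enum (phi y)
    & forall x z, reach h0 o x -> home z = q -> z \notin domf h ->
        oid_enum z < oid_enum (phi x) -> exists2 y, reach h0 o y & z = phi y].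

(* The graph of the partial function copy(v, q, g) = (v', g'). *)
Inductive copy : val -> place -> gheap -> val -> gheap -> Prop :=
| copy_oid o q (g : gheap) (h0 h : lheap) phi (h' : lheap) :
    g.[? home o] = Some h0 -> g.[? q] = Some h ->
    next_unused_renaming h0 o q h phi ->
    (forall x, reach h0 o x ->
       h'.[? phi x] = omap (rename_obj phi) h0.[? x]) ->
    (forall z, (forall x, reach h0 o x -> z <> phi x) ->
       h'.[? z] = h.[? z]) ->
    copy (VOid o) q g (VOid (phi o)) g.[q <- h']
| copy_gref r q g : copy (VGref r) q g (VGref r) g
| copy_exn v q g : copy (VExn v) q g (VExn v) g.

(* Expressions *)

Inductive econfig :=
| ERun of expr & lheap
| ETerm of lheap.

Inductive ectx :=
| CSel of field P
| CGref
| CValof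
| CRec of seq (field P * val) & field P & seq (field P * expr).

Definition val_fields (fvs : seq (field P * val)) : seq (field P * expr) :=
  [seq (fv.1, EVal fv.2) | fv <- fvs].

Definition eplug (C : ectx) (e : expr) : expr :=
  match C with
  | CSel f => ESel e f
  | CGref => EGref e
  | CValof => EValof e
  | CRec fvs f fes => ERec (val_fields fvs ++ (f, e) :: fes)
  end.

Inductive estep (p : place) : expr -> lheap -> label -> econfig -> Prop :=
| estep_new fvs (h : lheap) o :
    home o = p -> o \notin domf h ->
    estep p (ERec (val_fields fvs)) h Eps
      (ERun (EVal (VOid o)) h.[o <- mk_obj fvs])
| estep_sel o f (h : lheap) (r : obj) v :
    h.[? o] = Some r -> r.[? f] = Some v ->
    estep p (ESel (EVal (VOid o)) f) h Eps (ERun (EVal v) h)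
| estep_sel_bf o f (h : lheap) (r : obj) :
    h.[? o] = Some r -> f \notin domf r ->
    estep p (ESel (EVal (VOid o)) f) h (Sync excBF) (ETerm h)
| estep_gref o h (r : grobjid) :
    sval r = (o, p) ->
    estep p (EGref (EVal (VOid o))) h Eps (ERun (EVal (VGref r)) h)
| estep_valof o h (r : grobjid) :
    sval r = (o, p) ->
    estep p (EValof (EVal (VGref r))) h Eps (ERun (EVal (VOid o)) h)
| estep_valof_bg v h :
    (forall o (r : grobjid), sval r = (o, p) -> v <> VGref r) ->
    estep p (EValof (EVal v)) h (Sync excBG) (ETerm h)
| estep_ctx C e h lam e' h' :
    estep p e h lam (ERun e' h') ->
    estep p (eplug C e) h lam (ERun (eplug C e') h')
| estep_ctx_exn C e h lam :
    estep p e h lam (ETerm h) ->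
    estep p (eplug C e) h lam (ETerm h).

(* Statements *)

Inductive config :=
| Run of stmt & gheap
| Term of gheap.

Definition map_config (F : stmt -> stmt) (k : config) : config :=
  match k with Run s g => Run (F s) g | Term g => Term g end.

Inductive sctx :=
| CVal of var P & stmt
| CTarget of field P & expr
| CSource of oid P & field P
| CAt of place & var P & stmt.

Definition splug (C : sctx) (e : expr) : stmt :=
  match C with
  | CVal x s => SVal x e s
  | CTarget f e1 => SAssign e f e1
  | CSource o f => SAssign (EVal (VOid o)) f e
  | CAt q x s => SAt q x e s
  end.

Definition async_label (lam : label) : label :=
  match lam with Eps => Eps | Sync v | Async v => Async v end.

Definition end_finish_label (p : place) (g : gheap) (mu : {set exn}) : label :=
  if mu == set0 then Eps
  else if p \in domf g then Sync excE else Sync excDP.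

Definition at_label (p : place) (g : gheap) (lam : label) : label :=
  if is_sync_label lam && (p \notin domf g) then Sync excDP else lam.

(* [step p s g lam k] is the transition of <s, g> to k at place p with label
   lam. Rules given for both kinds of target are stated with [map_config] when
   a terminated target stays terminated. *)
Inductive step : place -> stmt -> gheap -> label -> config -> Prop :=
| step_skip p (g : gheap) :
    p \in domf g -> step p SSkip g Eps (Term g)
| step_throw p v (g : gheap) :
    p \in domf g -> step p (SThrow v) g (Sync v) (Term g)
| step_val p x v s (g : gheap) lam k :
    p \in domf g -> step p (subst_stmt v x s) g lam k ->
    step p (SVal x (EVal v) s) g lam k
| step_assign p o f v (g : gheap) (h : lheap) (r : obj) :
    g.[? p] = Some h -> h.[? o] = Some r -> f \in domf r ->
    step p (SAssign (EVal (VOid o)) f (EVal v)) g Eps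
      (Term g.[p <- h.[o <- r.[f <- v]]])
| step_assign_bf p o f v (g : gheap) (h : lheap) (r : obj) :
    g.[? p] = Some h -> h.[? o] = Some r -> f \notin domf r ->
    step p (SAssign (EVal (VOid o)) f (EVal v)) g (Sync excBF) (Term g)
| step_ctx p C e (g : gheap) (h : lheap) lam e' h' :
    g.[? p] = Some h -> estep p e h lam (ERun e' h') ->
    step p (splug C e) g lam (Run (splug C e') g.[p <- h'])
| step_ctx_exn p C e (g : gheap) (h : lheap) lam h' :
    g.[? p] = Some h -> estep p e h lam (ETerm h') ->
    step p (splug C e) g lam (Term g.[p <- h'])
| step_place_failure p s (g : gheap) :
    p \in domf g -> (p : nat) != 0 ->
    step p s g Eps (Run s g.[~ p])
| step_skip_failed p (g : gheap) :
    p \notin domf g -> step p SSkip g (Sync excDP) (Term g)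
| step_throw_failed p v (g : gheap) :
    p \notin domf g -> step p (SThrow v) g (Sync excDP) (Term g)
| step_val_failed p x e s (g : gheap) :
    p \notin domf g -> step p (SVal x e s) g (Sync excDP) (Term g)
| step_assign_failed p e1 f e2 (g : gheap) :
    p \notin domf g -> step p (SAssign e1 f e2) g (Sync excDP) (Term g)
| step_spawn p s (g : gheap) :
    p \in domf g -> step p (SAsync s) g Eps (Run (SBarAsync s) g)
| step_spawn_failed p s (g : gheap) :
    p \notin domf g -> step p (SAsync s) g (Sync excDP) (Term g)
| step_async p s (g : gheap) lam k :
    step p s g lam k ->
    step p (SBarAsync s) g (async_label lam) (map_config SBarAsync k)
| step_finish p mu s (g : gheap) lam s' g' :
    step p s g lam (Run s' g') ->
    step p (SFinish mu s) g Eps (Run (SFinish (add_label mu lam) s') g')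
| step_end_finish p mu s (g : gheap) lam g' :
    step p s g lam (Term g') ->
    step p (SFinish mu s) g (end_finish_label p g (add_label mu lam)) (Term g')
| step_seq p s t (g : gheap) lam s' g' :
    step p s g lam (Run s' g') -> ~~ is_sync_label lam ->
    step p (SSeq s t) g lam (Run (SSeq s' t) g')
| step_seq_exn p s t (g : gheap) lam s' g' :
    step p s g lam (Run s' g') -> is_sync_label lam ->
    step p (SSeq s t) g lam (Run s' g')
| step_par p t s (g : gheap) lam s' g' :
    is_async t -> step p s g lam (Run s' g') ->
    step p (SSeq t s) g lam (Run (SSeq t s') g')
| step_par_term p t s (g : gheap) lam g' :
    is_async t -> step p s g lam (Term g') ->
    step p (SSeq t s) g lam (Run t g')
| step_seq_term p s t (g : gheap) lam g' :
    p \in domf g -> step p s g lam (Term g') -> ~~ is_sync_label lam ->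
    step p (SSeq s t) g lam (Run t g')
| step_seq_term_exn p s t (g : gheap) lam g' :
    p \in domf g -> step p s g lam (Term g') -> is_sync_label lam ->
    step p (SSeq s t) g lam (Term g')
| step_seq_failed_sync p s t (g : gheap) lam g' :
    p \notin domf g -> step p s g lam (Term g') -> is_sync s ->
    step p (SSeq s t) g (Sync excDP) (Term g')
| step_seq_failed_async p s t (g : gheap) lam g' :
    p \notin domf g -> step p s g lam (Term g') -> is_async s ->
    step p (SSeq s t) g (Async excDP) (Run t g')
| step_shift p q x v s (g : gheap) v' g' :
    p \in domf g -> q \in domf g -> copy v q g v' g' ->
    step p (SAt q x (EVal v) s) g Eps
      (Run (SBarAt q (SSeq (subst_stmt v' x s) SSkip)) g')
| step_shift_failed p q x e s (g : gheap) :
    q \notin domf g \/ p \notin domf g ->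
    step p (SAt q x e s) g (Sync excDP) (Term g)
| step_at p q s (g : gheap) lam k :
    step q s g lam k ->
    step p (SBarAt q s) g (at_label p g lam) (map_config (SBarAt q) k)
| step_try p s t (g : gheap) lam k :
    step p s g lam k -> ~~ is_sync_label lam ->
    step p (STry s t) g lam (map_config (STry^~ t) k)
| step_catch p s t (g : gheap) lam s' g' :
    p \in domf g -> step p s g lam (Run s' g') -> is_sync_label lam ->
    step p (STry s t) g Eps (Run (SSeq s' t) g')
| step_catch_term p s t (g : gheap) lam g' :
    p \in domf g -> step p s g lam (Term g') -> is_sync_label lam ->
    step p (STry s t) g Eps (Run t g')
| step_try_failed p s t (g : gheap) k :
    p \notin domf g -> step p s g (Sync excDP) k ->
    step p (STry s t) g (Sync excDP) k.

End Calculus.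

(* Main.v *)
Require Import Defs.
From mathcomp Require Import all_boot.
From mathcomp Require Import finmap.

(** Induction on the derivation. At a failed place, a rule with a synchronous label either emits
    [excDP] itself or passes on the label of a premise at the same place and heap. *)

Theorem theorem4p5 (P : tx10) (p : place P) (s : stmt P) (g : gheap P)
  (lam : label) (k : config P) (v : exn)
  (wf_s : wf_stmt s)
  (p_failed : p \notin domf g)
  (s_step : step p s g lam k) :
  lam = Sync v -> v = excDP.
Proof.
have lheap_alive q (g0 : gheap P) (h : lheap P) :
    (g0.[? q])%fmap = Some h -> q \in domf g0.
  by move=> gq; rewrite -fndSome gq.
(* Only [SBarAt] changes the place, and there [at_label] masks the exception
   whatever the inner label is, so the induction hypothesis, whose premise
   concerns the inner place, is not needed. *)
move: v p_failed; clear wf_s.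
elim: s_step => {p s g lam k}; try by intros; eauto; congruence.
(* Up to the context rules: rules that fire only at a live place. *)
- by move=> p v g pg w; rewrite pg.
- by move=> p o f v g h r /lheap_alive pg _ _ w; rewrite pg.
- by move=> p C e g h lam e' h' /lheap_alive pg _ w; rewrite pg.
- by move=> p C e g h lam h' /lheap_alive pg _ w; rewrite pg.
(* [async_label] never yields [Sync]. *)
- by move=> p s g [].
(* Whatever was collected, a failed place reports only [Eps] or [Sync excDP]. *)
- move=> p mu s g lam g' _ _ v /negPf pg; rewrite /end_finish_label pg.
  by case: ifP => // _ [].
- move=> p q s g lam k _ _ v pg.
  by rewrite /at_label pg; case: lam => //= _ [].
Qed.
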